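(* For the $T$-round online Bayesian Stackelberg game with action feedback, with $n$ followers, $L$ leader actions, $A$ follower actions, $K$ types per follower, and an arbitrary unknown joint type distribution $\mathcal D$ on $\Theta^n$, there exists an action-feedback learning algorithm for the leader whose expected regret is $$\mathbb E[\mathrm{Reg}(T)]=O\big(K^n\sqrt T\,\log T\big).$$
   Context: Game. A leader has action set $\mathcal L=[L]=\{1,\dots,L\}$, $L\ge 2$, and commits to a mixed strategy $x\in\Delta(\mathcal L)$ (probability distributions on $\mathcal L$). There are $n\ge1$ followers, each with action set $\mathcal A=[A]$ and a private type in $\Theta=[K]$. The type profile $\theta=(\theta_1,\dots,\theta_n)\in\Theta^n$ is drawn from a joint distribution $\mathcal D$. If the leader plays $\ell$ and the followers play $a=(a_1,\dots,a_n)$, the leader gets $u(\ell,a)\in[0,1]$ and follower $i$ gets $v_i(\ell,a_i,\theta_i)\in[0,1]$ (no dependence on other followers' actions). Extend linearly: $u(x,a)=\sum_\ell x(\ell)u(\ell,a)$ and $v_i(x,a_i,\theta_i)=\sum_\ell x(\ell)v_i(\ell,a_i,\theta_i)$. The utility functions $u,v_1,\dots,v_n$ are known to the leader; $\mathcal D$ is not. Best response: $\mathrm{br}_i(\theta_i,x)\in\arg\max_{a\in\mathcal A}v_i(x,a,\theta_i)$, with ties broken in favor of the leader; $\mathbf{br}(\theta,x)=(\mathrm{br}_1(\theta_1,x),\dots,\mathrm{br}_n(\theta_n,x))$. Leader's expected utility: $U_{\mathcal D}(x)=\mathbb E_{\theta\sim\mathcal D}[u(x,\mathbf{br}(\theta,x))]$.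 Optimal strategy: $x^*\in\arg\max_{x\in\Delta(\mathcal L)}U_{\mathcal D}(x)$. Online interaction. In each round $t=1,\dots,T$: the leader chooses $x^t\in\Delta(\mathcal L)$ (possibly at random) based on past feedback; types $\theta^t\sim\mathcal D$ are drawn independently across rounds; followers myopically play $a^t=\mathbf{br}(\theta^t,x^t)$. An action-feedback algorithm observes only the joint action $a^t$ (not $\theta^t$) after round $t$. Regret: $\mathrm{Reg}(T)=\sum_{t=1}^T\big(U_{\mathcal D}(x^* )-U_{\mathcal D}(x^t)\big)$. *)

(* Defs.v *)
From HB Require Import structures.
From mathcomp Require Import all_boot all_order all_algebra.
From mathcomp Require Import all_classical all_reals all_analysis.
Set Implicit Arguments.
Unset Strict Implicit.
Unset Printing Implicit Defensive.
Import Order.TTheory GRing.Theory Num.Theory.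
Local Open Scope ring_scope.

Record dist (R : realType) (X : finType) := Dist {
  pmf :> {ffun X -> R};
  pmf_ge0 : forall a, 0 <= pmf a;
  pmf_sum1 : \sum_a pmf a = 1 }.

Notation action_profile n A := {ffun 'I_n -> 'I_A}.
Notation type_profile n K := {ffun 'I_n -> 'I_K}.

Record game (R : realType) (L n A K : nat) := Game {
  leader_payoff : 'I_L -> action_profile n A -> R;
  follower_payoff : 'I_n -> 'I_L -> 'I_A -> 'I_K -> R;
  leader_payoff_itv : forall l a, 0 <= leader_payoff l a <= 1;
  follower_payoff_itv : forall i l b k, 0 <= follower_payoff i l b k <= 1 }.

Section Game.
Variables (R : realType) (L n A K : nat) (G : game R L n A K).

Definition leader_utility (x : dist R 'I_L) (a : action_profile n A) : R :=
  \sum_l x l * leader_payoff G l a.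

Definition follower_utility (i : 'I_n) (x : dist R 'I_L) (b : 'I_A) (k : 'I_K)
    : R :=
  \sum_l x l * follower_payoff G i l b k.

Definition best_actions (i : 'I_n) (k : 'I_K) (x : dist R 'I_L) : {set 'I_A} :=
  [set b | [forall c, follower_utility i x c k <= follower_utility i x b k]].

Definition response := type_profile n K -> dist R 'I_L -> action_profile n A.

(* Ties are resolved at the level of the whole profile: [br theta x] maximizes
   the leader's utility over all profiles of individual best responses. The
   component [br theta x i] may therefore depend on the other followers' types,
   but only through the choice among the actions in
   [best_actions i (theta i) x]: a rule in which the choice of each follower
   depends on its own type only and which is leader-optimal for every [theta]
   need not exist. *)
Definition leader_favorable_response (br : response) : Prop :=
  forall theta x,
    (forall i, br theta x i \in best_actions i (theta i) x) /\
    (forall a : action_profile n A,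
       (forall i, a i \in best_actions i (theta i) x) ->
       leader_utility x a <= leader_utility x (br theta x)).

Definition expected_utility (br : response) (D : dist R (type_profile n K))
    (x : dist R 'I_L) : R :=
  \sum_theta D theta * leader_utility x (br theta x).

Definition optimal_strategy (br : response) (D : dist R (type_profile n K))
    (x : dist R 'I_L) : Prop :=
  forall y, expected_utility br D y <= expected_utility br D x.

End Game.

(* All the randomness of the leader is drawn upfront as a seed, from an
   arbitrary probability space; the strategy of a round is then a function of
   the seed and of the joint actions observed in the earlier rounds. Past
   strategies are functions of the same data, so they need not be recorded. *)
Record algorithm (R : realType) (L n A : nat) := Algorithm {
  seed_display : measure_display;
  seed : measurableType seed_display;
  seed_law : probability seed R;
  strategy : seed -> seq (action_profile n A) -> dist R 'I_L;
  measurable_strategy : forall h l,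
    measurable_fun [set: seed] (fun w => strategy w h l) }.

Section Interaction.
Variables (R : realType) (L n A K : nat) (G : game R L n A K).
Variables (br : response R L n A K) (alg : algorithm R L n A).

Definition history (w : seed alg) (thetas : seq (type_profile n K))
    : seq (action_profile n A) :=
  foldl (fun h theta => rcons h (br theta (strategy w h))) [::] thetas.

(* Rounds are numbered from 0, so the strategy of round [t] depends on the
   types drawn in the [t] rounds before it, through the actions they caused. *)
Definition played_strategy (w : seed alg) (thetas : seq (type_profile n K))
    (t : nat) : dist R 'I_L :=
  strategy w (history w (take t thetas)).

Definition regret (D : dist R (type_profile n K)) (xstar : dist R 'I_L)
    (T : nat) (w : seed alg) (thetas : T.-tuple (type_profile n K)) : R :=
  \sum_(t < T) (expected_utility G br D xstar
                - expected_utility G br D (played_strategy w thetas t)).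

(* The types are i.i.d. with law [D] and independent of the seed. *)
Definition expected_regret (D : dist R (type_profile n K))
    (xstar : dist R 'I_L) (T : nat) : \bar R :=
  (\int[seed_law alg]_w
     (\sum_(thetas : T.-tuple (type_profile n K))
        (\prod_(t < T) D (tnth thetas t)) * regret D xstar w thetas)%:E)%E.

End Interaction.

(* Main.v *)
Require Import Defs.
From HB Require Import structures.
From mathcomp Require Import all_boot all_order all_algebra.
From mathcomp Require Import all_classical all_reals all_analysis.
From mathcomp Require Import perm zify ring lra.
Set Implicit Arguments.
Unset Strict Implicit.
Unset Printing Implicit Defensive.
Import Order.TTheory GRing.Theory Num.Theory.
Local Open Scope ring_scope.

(* The leader faces a stochastic linear bandit: [U_D x] is the inner product of
   [D] with the feature vector [theta |-> u(x, br(theta, x))] of dimension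
   [d = K ^ n], which does not depend on how ties are broken among
   leader-optimal responses. Rounding the features to a grid of step [1 / T]
   leaves at most [(T + 1) ^ d] arms, on which exponential weights are run with
   importance-weighted least-squares estimates of the rewards, mixed with
   a small amount of exploration. The exploration distribution almost maximizes
   the determinant of its Gram matrix, so the estimates are of size O(d) divided
   by the exploration rate and their weighted second moments add up to at most
   [d]. The potential [log_partition eta / eta] minus the estimate of the best
   arm then bounds the regret by [d ln(T + 1) / eta + 12 eta d T + 1], and
   [eta = 1 / sqrt T] suffices; when [sqrt T <= 16 d] the bound exceeds the
   trivial one, [T]. *)

(** * Kernels of Gram matrices *)

(** Matrix determinant lemma: the two sides of [E] are triangular factorizations of the block matrix
    with rows [1, -v] and [u, A]. *)
Lemma det_rank1_update (F : fieldType) (r : nat) (A : 'M[F]_r) (u : 'cV_r)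
    (v : 'rV_r) : A \in unitmx ->
  \det (A + u *m v) = \det A * (1 + (v *m invmx A *m u) 0 0).
Proof.
move=> Au; set s := v *m invmx A *m u.
have E : block_mx 1%:M 0 u 1%:M *m block_mx 1%:M (- v) 0 (A + u *m v) =
    block_mx (1%:M + s) (- v) 0 A *m block_mx 1%:M 0 (invmx A *m u) 1%:M.
  rewrite !mulmx_block !(mul1mx, mulmx1, mul0mx, mulmx0, addr0, add0r).
  by rewrite mulmxN addrCA addNr addr0 mulNmx mulmxA addrK mulmxA mulmxV// mul1mx.
have := congr1 determinant E.
rewrite !det_mulmx !(det_lblock, det_ublock) !det1 !mul1r mulr1 => ->.
by rewrite mulrC (det_mx11 (1%:M + s)) !mxE eqxx.
Qed.

Section Gram.
Variables (R : realType) (N r : nat) (P : 'M[R]_(N, r)).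
Implicit Types (p : 'I_N -> R) (b c : 'I_N).

Definition gram p : 'M[R]_r := \sum_c p c *: ((row c P)^T *m row c P).

(** [gram_kernel p b c * y] is the least-squares estimate of the reward of arm [b] when arm [c],
    drawn from [p], has paid [y]. *)
Definition gram_kernel p b c : R :=
  (row b P *m invmx (gram p) *m (row c P)^T) 0 0.

Lemma trmx_gram p : (gram p)^T = gram p.
Proof.
rewrite /gram raddf_sum; apply: eq_bigr => c _ /=.
by rewrite linearZ /= trmx_mul trmxK.
Qed.

Lemma gram_kernelC p b c : gram_kernel p b c = gram_kernel p c b.
Proof.
rewrite /gram_kernel -[LHS]trace_mx11 -mxtrace_tr trace_mx11.
by rewrite trmx_mul trmxK trmx_mul trmx_inv trmx_gram mulmxA.
Qed.

(** If [v *m gram p = 0], then [v *m gram p *m v^T], a sum of squares of the entries of [P *m v^T]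
    with positive weights, vanishes; full column rank then gives [v = 0]. *)
Lemma gram_unit p : row_full P -> (forall c, 0 < p c) -> gram p \in unitmx.
Proof.
move=> Pf p0; rewrite -row_free_unit; apply/row_freeP.
suff /eqP k0 : kermx (gram p) == 0.
  by apply/row_freeP; rewrite -kermx_eq0 k0.
apply/eqP/row_matrixP => i; rewrite row0; set v := row i _.
have vQ : v *m gram p = 0 by rewrite -row_mul mulmx_ker row0.
have : (v *m gram p *m v^T) 0 0 = 0 by rewrite vQ mul0mx mxE.
rewrite mulmx_sumr mulmx_suml summxE => s0.
have E c : (v *m (p c *: ((row c P)^T *m row c P)) *m v^T) 0 0 =
    p c * ((P *m v^T) c 0) ^+ 2.
  rewrite -scalemxAr -scalemxAl mxE; congr (_ * _).
  rewrite mulmxA -(mulmxA (v *m _)) [LHS]mxE big_ord1 expr2.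
  have -> : (row c P *m v^T) 0 0 = (P *m v^T) c 0.
    by rewrite -row_mul mxE.
  congr (_ * _); rewrite -[LHS]trace_mx11 -mxtrace_tr trace_mx11.
  by rewrite trmx_mul trmxK -row_mul mxE.
have Pv : P *m v^T = 0.
  apply/matrixP => c j; rewrite (ord1 j) [RHS]mxE.
  have := s0; under eq_bigr do rewrite E.
  move/eqP; rewrite psumr_eq0; last first.
    by move=> e _; apply: mulr_ge0; [exact/ltW|exact: sqr_ge0].
  move=> /allP /(_ c); rewrite mem_index_enum => /(_ isT) /=.
  by rewrite mulf_eq0 gt_eqF//= sqrf_eq0 => /eqP.
have : v^T = 0 by apply: (row_full_inj Pf); rewrite Pv mulmx0.
by move/(congr1 trmx); rewrite trmxK trmx0.
Qed.

(** Unbiasedness of the estimates for rewards linear in the features: insert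
    [invmx (gram p) *m gram p] after [row b P] and expand the second factor. *)
Lemma gram_kernel_repr p b (beta : 'cV_r) : gram p \in unitmx ->
  \sum_c p c * gram_kernel p b c * (P *m beta) c 0 = (P *m beta) b 0.
Proof.
move=> Qu.
have -> : (P *m beta) b 0 =
    (row b P *m invmx (gram p) *m gram p *m beta) 0 0.
  by rewrite mulmxKV// -row_mul [RHS]mxE.
rewrite {2}/gram mulmx_sumr mulmx_suml summxE; apply: eq_bigr => c _.
rewrite -scalemxAr -scalemxAl [RHS]mxE -mulrA; congr (_ * _).
rewrite mulmxA -(mulmxA (_ *m _)) [RHS]mxE big_ord1.
by rewrite -(row_mul c) [row c _ 0 0]mxE.
Qed.

(** As a function of [e], [gram_kernel f e c] is itself linear in the features, so the reproducing
    identity applies to it. *)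
Lemma gram_kernel_sum p (f : 'I_N -> R) b c : gram p \in unitmx ->
  \sum_e p e * gram_kernel p b e * gram_kernel f e c = gram_kernel f b c.
Proof.
move=> Qu; pose beta := invmx (gram f) *m (row c P)^T.
have E e : gram_kernel f e c = (P *m beta) e 0.
  by rewrite /gram_kernel /beta -mulmxA -row_mul mxE.
rewrite E -(gram_kernel_repr b beta Qu).
by apply: eq_bigr => e _; rewrite E.
Qed.

Lemma gram_kernel_sqr p b : gram p \in unitmx ->
  \sum_c p c * gram_kernel p b c ^+ 2 = gram_kernel p b b.
Proof.
move=> Qu; rewrite -[RHS](gram_kernel_sum p b b Qu).
by apply: eq_bigr => c _; rewrite expr2 mulrA (gram_kernelC p c b).
Qed.

Lemma gram_kernel_trace p : gram p \in unitmx ->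
  \sum_b p b * gram_kernel p b b = r%:R.
Proof.
move=> Qu; rewrite -(@mxtrace1 R r) -(mulVmx Qu) {2}/gram mulmx_sumr raddf_sum /=.
apply: eq_bigr => b _; rewrite -scalemxAr linearZ /=; congr (_ * _).
by rewrite mulmxA mxtrace_mulC mulmxA /gram_kernel [RHS]trace_mx11.
Qed.

Lemma gram_kernel_ge0 p b : gram p \in unitmx -> (forall c, 0 <= p c) ->
  0 <= gram_kernel p b b.
Proof.
move=> Qu p0; rewrite -gram_kernel_sqr//.
by apply: sumr_ge0 => c _; rewrite mulr_ge0// sqr_ge0.
Qed.

(** Cauchy-Schwarz in AM-GM form: the kernel is a [p]-weighted sum of products, and the weighted
    sums of squares are diagonal entries. *)
Lemma gram_kernel_bound p (B : R) b c : gram p \in unitmx ->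
    (forall e, 0 <= p e) -> (forall e, gram_kernel p e e <= B) ->
  `|gram_kernel p b c| <= B.
Proof.
move=> Qu p0 pB.
apply: (@le_trans _ _ ((gram_kernel p b b + gram_kernel p c c) / 2)); last first.
  by have := pB b; have := pB c; lra.
rewrite -(gram_kernel_sum p b c Qu) -(gram_kernel_sqr b Qu) -(gram_kernel_sqr c Qu).
rewrite -big_split /= mulr_suml; apply: le_trans (ler_norm_sum _ _ _) _.
apply: ler_sum => e _; rewrite (gram_kernelC p e c) -mulrDr -!mulrA.
rewrite normrM ger0_norm//; apply: ler_wpM2l => //.
set x := gram_kernel _ _ _; set y := gram_kernel _ _ _.
have : 0 <= (x - y) ^+ 2 by exact: sqr_ge0.
have : 0 <= (x + y) ^+ 2 by exact: sqr_ge0.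
by move=> h1 h2; rewrite ler_norml; apply/andP; split; nra.
Qed.

(* AM-GM replaces the operator monotonicity of the inverse. *)
Lemma gram_kernel_antimono p mu (g B : R) b : 0 < g ->
    gram p \in unitmx -> gram mu \in unitmx ->
    (forall c, 0 <= mu c) -> (forall c, g * mu c <= p c) ->
    gram_kernel mu b b <= B ->
  gram_kernel p b b <= B / g.
Proof.
move=> g0 pu muu mu0 gmu muB.
(* The left side is a [mu]-weighted sum of products of the two kernels. AM-GM with weight [g], then
   [g * mu <= p], turns it into diagonal terms, and half of the left side is absorbed. *)
have : gram_kernel p b b <= (gram_kernel mu b b / g + gram_kernel p b b) / 2.
  rewrite -{1}(gram_kernel_sum p b b muu) -(gram_kernel_sqr b muu).
  rewrite -(gram_kernel_sqr b pu) [_ / g]mulr_suml -big_split /= mulr_suml.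
  apply: ler_sum => e _; rewrite (gram_kernelC p e b).
  set x := gram_kernel _ _ _; set y := gram_kernel _ _ _.
  apply: (@le_trans _ _ ((mu e * x ^+ 2 / g + g * mu e * y ^+ 2) / 2)).
    have -> : (mu e * x ^+ 2 / g + g * mu e * y ^+ 2) / 2 =
        mu e * x * y + mu e * (x - g * y) ^+ 2 / g / 2.
      by field; exact: lt0r_neq0.
    by rewrite lerDl divr_ge0// divr_ge0 ?(ltW g0)// mulr_ge0// sqr_ge0.
  apply: ler_wpM2r; first by lra.
  by rewrite lerD2l; apply: ler_wpM2r; [exact: sqr_ge0|exact: gmu].
have : gram_kernel mu b b / g <= B / g by rewrite ler_pM2r// invr_gt0.
lra.
Qed.

End Gram.

(** * Almost D-optimal exploration *)

Section Distributions.
Variables (R : realType) (X : finType).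

Lemma exists_dist (f : X -> R) : (forall x, 0 <= f x) -> \sum_x f x = 1 ->
  {p : dist R X | p =1 f}.
Proof.
move=> f0 f1; have p0 a : 0 <= [ffun x => f x] a by rewrite ffunE.
have p1 : \sum_a [ffun x => f x] a = 1.
  by rewrite -f1; apply: eq_bigr => a _; rewrite ffunE.
by exists (Dist p0 p1) => x; rewrite ffunE.
Qed.

Lemma exists_point_mass (a : X) : {p : dist R X | forall f : X -> R,
  \sum_x p x * f x = f a}.
Proof.
have [||p pE] := @exists_dist (fun x => (x == a)%:R).
- by move=> x; rewrite ler0n.
- by rewrite (bigD1 a)//= eqxx big1 ?addr0// => i /negbTE ->.
exists p => f; rewrite (bigD1 a)//= pE eqxx mul1r big1 ?addr0// => i.
by rewrite pE => /negbTE ->; rewrite mul0r.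
Qed.

Lemma exists_mixture (p q : dist R X) (s : R) : 0 <= s <= 1 ->
  {m : dist R X | forall x, m x = (1 - s) * p x + s * q x}.
Proof.
move=> /andP[s0 s1]; apply: exists_dist => [x|].
  by rewrite addr_ge0// mulr_ge0 ?Defs.pmf_ge0// subr_ge0.
by rewrite big_split /= -!mulr_sumr !pmf_sum1; ring.
Qed.

Lemma exists_uniform (a : X) : {p : dist R X | forall x, 0 < p x}.
Proof.
have X0 : (0 < #|X|)%N by apply/card_gt0P; exists a.
have [||p pE] := @exists_dist (fun=> #|X|%:R^-1).
- by move=> _; rewrite invr_ge0 ler0n.
- by rewrite sumr_const -[LHS]mulr_natr mulVf// pnatr_eq0 -lt0n.
by exists p => x; rewrite pE invr_gt0 ltr0n.
Qed.

Lemma dist_le1 (p : dist R X) (x : X) : p x <= 1.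
Proof.
rewrite -(pmf_sum1 p) (bigD1 x)//= lerDl.
by apply: sumr_ge0 => y _; exact: Defs.pmf_ge0.
Qed.

Lemma dist_mean_le (p : dist R X) (f : X -> R) (B : R) :
  (forall x, f x <= B) -> \sum_x p x * f x <= B.
Proof.
move=> fB; apply: (@le_trans _ _ (\sum_x p x * B)).
  by apply: ler_sum => x _; apply: ler_wpM2l; [exact: Defs.pmf_ge0|].
by rewrite -mulr_suml pmf_sum1 mul1r.
Qed.

Lemma dist_mean_ge0 (p : dist R X) (f : X -> R) :
  (forall x, 0 <= f x) -> 0 <= \sum_x p x * f x.
Proof. by move=> f0; apply: sumr_ge0 => x _; rewrite mulr_ge0// Defs.pmf_ge0. Qed.

End Distributions.

Section Design.
Variables (R : realType) (N r : nat) (P : 'M[R]_(N, r)).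
Hypothesis P_full : row_full P.

(** Leibniz expansion with all weights at most 1; it makes the supremum of the determinants over all
    designs finite. *)
Lemma det_gram_bound : exists B : R, forall nu : dist R 'I_N,
  `|\det (gram P nu)| <= B.
Proof.
exists (\sum_(s : 'S_r) \prod_i \sum_c `|P c i * P c (s i)|) => nu.
rewrite /determinant; apply: le_trans (ler_norm_sum _ _ _) _.
apply: ler_sum => s _; rewrite normrM normrX normrN1 expr1n mul1r normr_prod.
apply: ler_prod => i _; rewrite normr_ge0 /= /gram summxE.
apply: le_trans (ler_norm_sum _ _ _) _; apply: ler_sum => c _.
rewrite !mxE big_ord1 !mxE normrM ger0_norm ?Defs.pmf_ge0//.
by rewrite -[leRHS]mul1r ler_wpM2r// dist_le1.
Qed.

Lemma exists_almost_D_optimal (b0 : 'I_N) : exists mu : dist R 'I_N,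
  gram P mu \in unitmx /\
  forall nu : dist R 'I_N, `|\det (gram P nu)| <= 3 / 2 * `|\det (gram P mu)|.
Proof.
have [B detB] := det_gram_bound.
pose E : set R := range (fun nu : dist R 'I_N => `|\det (gram P nu)|).
have [unif unif0] := exists_uniform R b0.
have Esup : has_sup E.
  split; first by exists `|\det (gram P unif)|, unif.
  by exists B => _ [nu _ <-]; exact: detB.
have leE (nu : dist R 'I_N) : `|\det (gram P nu)| <= sup E.
  by apply: sup_upper_bound => //; exists nu.
have sup0 : 0 < sup E.
  apply: lt_le_trans (leE unif); rewrite normr_gt0.
  by rewrite -unitfE -unitmxE gram_unit.
(* A value above two thirds of the supremum gives the factor 3/2; the uniform design makes the
   supremum positive, hence [gram P mu] invertible. *)
have [|_ [mu _ <-] mu_sup] := @sup_adherent _ E (sup E / 3) _ Esup.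
  by rewrite divr_gt0.
exists mu; split; last by move=> nu; have := leE nu; lra.
by rewrite unitmxE unitfE -normr_gt0; lra.
Qed.

(* Moving mass [s] from an almost optimal design to the arm [b] multiplies
   the determinant by [(1 - s) ^ r * (1 + s / (1 - s) * gram_kernel b b)]. *)
Lemma exists_exploration (b0 : 'I_N) (d : nat) : (r <= d)%N -> (0 < d)%N ->
  exists mu : dist R 'I_N, gram P mu \in unitmx /\
    forall b, gram_kernel P mu b b <= 4 * d%:R.
Proof.
move=> rd d0; have [mu [muu mumax]] := exists_almost_D_optimal b0.
exists mu; split=> // b; set k := gram_kernel _ _ _ _.
have k0 : 0 <= k by apply: gram_kernel_ge0 => // c; exact: Defs.pmf_ge0.
have dR : 1 <= d%:R :> R by rewrite ler1n.
(* With [s * d = 1/2], Bernoulli's inequality gives [(1 - s) ^ r >= 1/2]. Near-optimality then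
   forces [1 + s / (1 - s) * k <= 3], so [s * k <= 2 = s * (4 * d)]. *)
pose s : R := (2 * d%:R)^-1.
have s0 : 0 < s by rewrite invr_gt0; lra.
have sd : s * d%:R = 1 / 2 by rewrite /s; field; lra.
have s2 : s <= 1 / 2 by rewrite -sd ler_peMr// ltW.
have [e eE] := exists_point_mass R b.
have [|nu nuE] := @exists_mixture _ _ mu e s; first by apply/andP; split; lra.
have gnu : gram P nu = (1 - s) *: gram P mu + (s *: (row b P)^T) *m row b P.
  rewrite /gram scaler_sumr -scalemxAl.
  transitivity (\sum_c ((1 - s) *: (mu c *: ((row c P)^T *m row c P))
      + s *: (e c *: ((row c P)^T *m row c P)))).
    by apply: eq_bigr => c _; rewrite nuE !scalerA -scalerDl.
  rewrite big_split /=; congr (_ + _); rewrite -scaler_sumr; congr (_ *: _).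
  by apply/matrixP => i j; rewrite summxE -[RHS](eE
    (fun c => ((row c P)^T *m row c P) i j)); apply: eq_bigr => c _; rewrite mxE.
have s1u : (1 - s) \is a GRing.unit by rewrite unitfE; lra.
have smu : (1 - s) *: gram P mu \in unitmx by rewrite unitmxZ.
have := mumax nu; rewrite gnu det_rank1_update// detZ invmxZ//
  -!scalemxAr -!scalemxAl mxE mxE -/k.
rewrite -/(gram_kernel P mu b b) -/k.
have t0 : 0 <= s * ((1 - s)^-1 * k) by rewrite !mulr_ge0// ?invr_ge0; lra.
rewrite !normrM normrX [X in _ * X]ger0_norm; last by rewrite addr_ge0.
rewrite (ger0_norm (_ : 0 <= 1 - s)); last by lra.
rewrite mulrAC ler_pM2r; last by rewrite normr_gt0 -unitfE -unitmxE.
have bern m : 1 - m%:R * s <= (1 - s) ^+ m.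
  elim: m => [|m IH]; first by rewrite mul0r subr0 expr0.
  rewrite exprS; apply: le_trans (_ : (1 - s) * (1 - m%:R * s) <= _).
    rewrite -natr1; have : 0 <= m%:R * s * s by rewrite !mulr_ge0// ltW.
    nra.
  by rewrite ler_wpM2l//; lra.
have half : 1 / 2 <= (1 - s) ^+ r.
  apply: le_trans (bern r); have : r%:R * s <= d%:R * s.
    by rewrite ler_wpM2r ?ler_nat// ltW.
  by rewrite mulrC (mulrC d%:R) sd => h; rewrite mulrC; lra.
have sk : s * k <= s * ((1 - s)^-1 * k).
  rewrite ler_wpM2l ?(ltW s0)// ler_peMl// invf_ge1; lra.
set t := s * (_ * _) in t0 sk *; move=> h.
have t2 : t <= 2 by nra.
have : s * k <= s * (4 * d%:R) by rewrite mulrCA sd; lra.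
by rewrite ler_pM2l.
Qed.

End Design.

(** * Exponential weights *)

(** From [expR (- x) >= 1 - x] and [(1 + x + 2 x^2) (1 - x) = 1 + x^2 (1 - 2 x) >= 1]. *)
Lemma expR_le_quadratic (R : realType) (x : R) : x <= 1 / 2 ->
  expR x <= 1 + x + 2 * x ^+ 2.
Proof.
move=> x2; have e0 := expR_gt0 x.
have : 1 - x <= (expR x)^-1 by rewrite -expRN; have := expR_ge1Dx (- x).
have e1 : expR x * (expR x)^-1 = 1 by rewrite mulfV// gt_eqF.
have x20 : 0 <= x ^+ 2 * (1 - 2 * x) by rewrite mulr_ge0 ?sqr_ge0//; lra.
rewrite -(ler_pM2l e0) e1 => h.
rewrite -(@ler_pM2r _ (1 - x)); last by lra.
by apply: le_trans h _; nra.
Qed.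

Section ExponentialWeights.
Variables (R : realType) (N : nat).

Definition log_partition (eta : R) (G : 'I_N -> R) : R :=
  ln (\sum_b expR (eta * G b)).

Lemma partition_gt0 (eta : R) (G : 'I_N -> R) (b : 'I_N) :
  0 < \sum_b expR (eta * G b).
Proof.
rewrite (bigD1 b)//= ltr_pwDl ?expR_gt0//.
by apply: sumr_ge0 => i _; exact: expR_ge0.
Qed.

Lemma exists_softmax (eta : R) (G : 'I_N -> R) (b0 : 'I_N) :
  {q : dist R 'I_N | forall b,
    q b = expR (eta * G b) / \sum_c expR (eta * G c)}.
Proof.
have Z0 := partition_gt0 eta G b0; apply: exists_dist => [b|].
  by rewrite divr_ge0 ?expR_ge0// ltW.
by rewrite -mulr_suml mulfV// gt_eqF.
Qed.

Lemma log_partition_ge (eta : R) (G : 'I_N -> R) (b : 'I_N) :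
  eta * G b <= log_partition eta G.
Proof.
have Z0 := partition_gt0 eta G b.
rewrite /log_partition -[leLHS]expRK ler_ln ?posrE ?expR_gt0//.
rewrite (bigD1 b)//= lerDl; apply: sumr_ge0 => i _; exact: expR_ge0.
Qed.

(** The ratio of the new partition function to the old one is the [q]-mean of [expR (eta * x b)];
    bound it by the quadratic estimate and use [ln (1 + z) <= z]. *)
Lemma log_partition_step (eta : R) (G x : 'I_N -> R) (q : dist R 'I_N) :
    (forall b, q b = expR (eta * G b) / \sum_c expR (eta * G c)) ->
    (forall b, eta * x b <= 1 / 2) ->
  log_partition eta (fun b => G b + x b) <=
    log_partition eta G + \sum_b q b * (eta * x b + 2 * (eta * x b) ^+ 2).
Proof.
move=> qE x2; have b0 : 'I_N.
  case: N G x q qE x2 => [|m] G x q _ _; last exact: ord0.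
  by have := Defs.pmf_sum1 q; rewrite big_ord0 => /eqP; rewrite eq_sym oner_eq0.
have Z0 := partition_gt0 eta G b0; set Z := \sum_b expR _ in Z0 qE.
have S0 : 0 < \sum_b q b * expR (eta * x b).
  rewrite (bigD1 b0)//= ltr_pwDl//; first by rewrite qE !(mulr_gt0, expR_gt0, invr_gt0).
  by apply: sumr_ge0 => i _; rewrite mulr_ge0 ?Defs.pmf_ge0 ?expR_ge0.
have -> : log_partition eta (fun b => G b + x b) =
    log_partition eta G + ln (\sum_b q b * expR (eta * x b)).
  rewrite /log_partition -lnM ?posrE//; congr ln.
  rewrite mulr_sumr; apply: eq_bigr => b _.
  by rewrite qE mulrA mulrCA -/Z mulfV ?gt_eqF// mulr1 -expRD mulrDr.
rewrite lerD2l; set z := \sum_b q b * (_ + _).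
have Sz : \sum_b q b * expR (eta * x b) <= 1 + z.
  rewrite -(Defs.pmf_sum1 q) -big_split /=; apply: ler_sum => b _.
  rewrite -{2}[q b]mulr1 -mulrDr ler_wpM2l ?Defs.pmf_ge0//.
  by rewrite addrA; exact: expR_le_quadratic.
have z0 : 0 < 1 + z by exact: lt_le_trans Sz.
apply: (@le_trans _ _ (ln (1 + z))); first by rewrite ler_ln.
by apply: le_ln1Dx; rewrite -subr_gt0 opprK addrC.
Qed.

(* [y c] is the reward of arm [c] in the current round; [k b c * y c] is the
   unbiased estimate of [y b] formed when arm [c] is played. *)
Lemma exponential_weights_step (eta gamma d : R) (G : 'I_N -> R)
    (q p mu : dist R 'I_N) (k : 'I_N -> 'I_N -> R) (y : 'I_N -> R) :
    0 < eta -> 0 <= gamma <= 1 / 2 ->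
    (forall b, q b = expR (eta * G b) / \sum_c expR (eta * G c)) ->
    (forall b, p b = (1 - gamma) * q b + gamma * mu b) ->
    (forall b, 0 <= y b <= 1) ->
    (forall b, \sum_c p c * k b c * y c = y b) ->
    (forall b, \sum_c p c * k b c ^+ 2 = k b b) ->
    \sum_b p b * k b b <= d ->
    (forall b c, eta * `|k b c| <= 1 / 2) ->
  forall b', \sum_c p c * (y b' - y c +
      (log_partition eta (fun b => G b + k b c * y c) / eta
         - (G b' + k b' c * y c)))
    <= log_partition eta G / eta - G b' + (gamma + 4 * eta * d).
Proof.
move=> eta0 /andP[g0 g2] qE pE y01 krepr ksqr ktr kbound b'.
have y1 b : y b ^+ 2 <= 1 by have /andP[u v] := y01 b; nra.
have k0 b : 0 <= k b b.
  rewrite -ksqr; apply: sumr_ge0 => c _.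
  by rewrite mulr_ge0 ?sqr_ge0// Defs.pmf_ge0.
have step c : log_partition eta (fun b => G b + k b c * y c) / eta <=
    log_partition eta G / eta
      + \sum_b q b * (k b c * y c + 2 * eta * k b c ^+ 2).
  rewrite ler_pdivrMr// mulrDl divfK ?gt_eqF//.
  apply: le_trans (log_partition_step qE _) _.
    move=> b; apply: le_trans (kbound b c); rewrite ler_pM2l//.
    apply: le_trans (ler_norm _) _; have /andP[u v] := y01 c.
    by rewrite normrM (ger0_norm u) ler_piMr.
  rewrite lerD2l mulr_suml; apply: ler_sum => b _.
  rewrite -[leRHS]mulrA; apply: ler_wpM2l; first exact: Defs.pmf_ge0.
  rewrite [leRHS]mulrDl (mulrC (k b c * y c)) lerD2l !exprMn.
  have : eta * eta * k b c ^+ 2 * y c ^+ 2 <= eta * eta * k b c ^+ 2 * 1.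
    by apply: ler_wpM2l (y1 c); rewrite mulr_ge0 ?sqr_ge0// ltW// mulr_gt0.
  by lra.
apply: (@le_trans _ _ (\sum_c p c * (y b' - y c +
    (log_partition eta G / eta
      + \sum_b q b * (k b c * y c + 2 * eta * k b c ^+ 2)
      - (G b' + k b' c * y c))))).
  apply: ler_sum => c _; apply: ler_wpM2l; first exact: Defs.pmf_ge0.
  by rewrite lerD2l lerD2r.
pose A := y b' + log_partition eta G / eta - G b'.
(* Averaging over the played arm [c] replaces estimates by true rewards ([krepr]) and squares by
   diagonal entries ([ksqr]). *)
have -> : \sum_c p c * (y b' - y c +
    (log_partition eta G / eta
      + \sum_b q b * (k b c * y c + 2 * eta * k b c ^+ 2)
      - (G b' + k b' c * y c))) =
    A - \sum_c p c * y c
      + (\sum_b q b * y b + 2 * eta * \sum_b q b * k b b) - y b'.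
  transitivity (\sum_c (p c * A - p c * y c
      + p c * \sum_b q b * (k b c * y c + 2 * eta * k b c ^+ 2)
      - p c * k b' c * y c)).
    by apply: eq_bigr => c _; rewrite /A; ring.
  rewrite sumrB krepr big_split sumrB -mulr_suml Defs.pmf_sum1 mul1r /=.
  congr (_ + _ - _).
  under eq_bigr do rewrite mulr_sumr.
  rewrite exchange_big mulr_sumr -big_split; apply: eq_bigr => b _ /=.
  rewrite -(krepr b) -(ksqr b) !mulr_sumr -big_split.
  by apply: eq_bigr => c _ /=; ring.
have qy0 : 0 <= \sum_b q b * y b.
  by apply: dist_mean_ge0 => b; have /andP[] := y01 b.
have muy0 : 0 <= \sum_b mu b * y b.
  by apply: dist_mean_ge0 => b; have /andP[] := y01 b.
have qy1 : \sum_b q b * y b <= 1.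
  by apply: dist_mean_le => b; have /andP[] := y01 b.
have py : \sum_c p c * y c =
    (1 - gamma) * \sum_b q b * y b + gamma * \sum_b mu b * y b.
  rewrite !mulr_sumr -big_split; apply: eq_bigr => b _ /=.
  by rewrite pE; ring.
(* Since [gamma <= 1/2], [q <= 2 p] pointwise; this doubling turns [2 * eta] into the final
   [4 * eta * d]. *)
have qk : \sum_b q b * k b b <= 2 * d.
  apply: (@le_trans _ _ (\sum_b 2 * (p b * k b b))).
    apply: ler_sum => b _; rewrite mulrA; apply: ler_wpM2r => //.
    rewrite pE; have := Defs.pmf_ge0 mu b; have := Defs.pmf_ge0 q b.
    by move=> u v; nra.
  by rewrite -mulr_sumr ler_pM2l.
have := ler_wpM2l (ltW eta0) qk.
have : gamma * \sum_b q b * y b <= gamma by rewrite ler_piMr.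
have : 0 <= gamma * \sum_b mu b * y b by rewrite mulr_ge0.
by rewrite py /A; lra.
Qed.

End ExponentialWeights.

(** The one-round drift holds for each fixed [th], so it survives averaging over any law of the
    types, and neither [p] nor [k] depends on that law. *)
Lemma exists_exp2_policy (R : realType) (N : nat) (Th : finType)
    (M : 'I_N -> Th -> R) (eta : R) :
    (0 < N)%N -> (0 < #|Th|)%N -> (forall c th, 0 <= M c th <= 1) ->
    0 < eta -> 16 * eta * #|Th|%:R <= 1 ->
  exists (p : ('I_N -> R) -> dist R 'I_N)
    (k : ('I_N -> R) -> 'I_N -> 'I_N -> R),
  forall G th b', \sum_c p G c * (M b' th - M c th +
      (log_partition eta (fun b => G b + k G b c * M c th) / eta
         - (G b' + k G b' c * M c th)))
    <= log_partition eta G / eta - G b' + 12 * eta * #|Th|%:R.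
Proof.
move=> N0 Th0 M01 eta0 etad; pose b0 := Ordinal N0; set d : R := #|Th|%:R in etad *.
have d0 : 0 < d by rewrite ltr0n.
(* The reward vectors of the arms are the columns of [X]. Features are taken from a column basis: it
   has full column rank, and its width is the rank of [X], at most [#|Th|]. *)
pose X := \matrix_(c < N, j < #|Th|) M c (enum_val j).
pose P := col_base X.
have [mu [muu mu4]] := exists_exploration (col_base_full X) b0 (rank_leq_col X) Th0.
(* Exploration bounds the kernel by [4 * d / gamma], so this choice makes [eta] times that bound
   exactly 1/2. *)
pose gamma := 8 * eta * d.
have g0 : 0 < gamma by rewrite !mulr_gt0//; lra.
have g2 : gamma <= 1 / 2 by rewrite /gamma; lra.
have mixP G : {p : dist R 'I_N | forall b,
    p b = (1 - gamma) * projT1 (exists_softmax eta G b0) b + gamma * mu b}.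
  by apply: exists_mixture; apply/andP; split; lra.
pose p G := projT1 (mixP G).
exists p, (fun G => gram_kernel P (p G)) => G th b'.
have pE := projT2 (mixP G); have qE := projT2 (exists_softmax eta G b0).
rewrite -/(p G) in pE; set q := projT1 _ in pE qE.
have q0 b : 0 < q b.
  by rewrite qE divr_gt0 ?expR_gt0// (partition_gt0 _ _ b0).
have p0 b : 0 < p G b.
  rewrite pE ltr_pwDl//; first by rewrite mulr_gt0//; lra.
  by rewrite mulr_ge0 ?Defs.pmf_ge0// ltW.
have pu := gram_unit (col_base_full X) p0.
have kB b : gram_kernel P (p G) b b <= 4 * d / gamma.
  apply: (gram_kernel_antimono g0 pu muu) (mu4 b) => c; first exact: Defs.pmf_ge0.
  by rewrite pE lerDr mulr_ge0 ?(ltW (q0 _))//; lra.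
have -> : 12 * eta * d = gamma + 4 * eta * d by rewrite /gamma; ring.
have Mth c : M c th = (P *m col (enum_rank th) (row_base X)) c 0.
  rewrite -[LHS](_ : X c (enum_rank th) = _); last by rewrite mxE enum_rankK.
  rewrite -[in LHS](mulmx_base X) !mxE.
  by apply: eq_bigr => j _; rewrite [col _ _ _ _]mxE.
apply: (exponential_weights_step eta0 _ qE pE) => //.
- by rewrite (ltW g0).
- move=> b; under eq_bigr do rewrite Mth; rewrite Mth.
  exact: gram_kernel_repr.
- by move=> b; exact: gram_kernel_sqr.
- by rewrite gram_kernel_trace// ler_nat rank_leq_col.
move=> b c; apply: le_trans (_ : eta * (4 * d / gamma) <= _).
  rewrite ler_pM2l//; apply: gram_kernel_bound => // e; exact: ltW.
have -> : eta * (4 * d / gamma) = 1 / 2; last by [].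
by rewrite /gamma; field; rewrite !gt_eqF.
Qed.

(** * Randomized strategies as random trees *)

Section RandomStrategy.
Variables (R : realType) (I A Th : finType) (S : Type).
Variables (policy : S -> dist R I) (update : S -> I -> A -> S).

(* A deterministic strategy for [m] rounds: an action for the current round
   and, for each possible observation, a strategy for the remaining rounds. *)
Fixpoint strategy_tree (m : nat) : finType :=
  if m is m'.+1 then (I * {ffun A -> strategy_tree m'})%type else unit.

(** Serves as the default element when seeds are decoded into trees. *)
Fixpoint constant_tree (i0 : I) (m : nat) : strategy_tree m :=
  if m is m'.+1 then (i0, [ffun=> constant_tree i0 m']) else tt.

Fixpoint tree_action (i0 : I) (m : nat) : strategy_tree m -> seq A -> I :=
  match m with
  | 0 => fun _ _ => i0
  | m'.+1 => fun s h =>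
      if h is a :: h' then tree_action i0 (s.2 a) h' else s.1
  end.

(** At each node the subtrees for the different observations are drawn independently, each from the
    state updated with its observation. *)
Fixpoint tree_law (m : nat) : S -> strategy_tree m -> R :=
  match m with
  | 0 => fun _ _ => 1
  | m'.+1 => fun st s =>
      policy st s.1 * \prod_a tree_law (update st s.1 a) (s.2 a)
  end.

(** Absorb [F] into the factor at [a0] and exchange sum and product: every other factor sums to 1.
    It discards the subtrees of observations that did not occur. *)
Lemma sum_prod_marginal (T : finType) (w : A -> T -> R) (a0 : A) (F : T -> R) :
    (forall a, \sum_t w a t = 1) ->
  \sum_(f : {ffun A -> T}) (\prod_a w a (f a)) * F (f a0) =
  \sum_t w a0 t * F t.
Proof.
move=> w1; pose w' a t := w a t * (if a == a0 then F t else 1).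
transitivity (\sum_(f : {ffun A -> T}) \prod_a w' a (f a)).
  apply: eq_bigr => f _; rewrite big_split /=; congr (_ * _).
  by rewrite -big_mkcond big_pred1_eq.
rewrite -bigA_distr_bigA (bigD1 a0)//= [X in _ * X]big1 ?mulr1; last first.
  move=> a /negbTE aa0; rewrite -[RHS](w1 a).
  by apply: eq_bigr => t _; rewrite /w' aa0 mulr1.
by apply: eq_bigr => t _; rewrite /w' eqxx.
Qed.

Lemma tree_law_ge0 m st (s : strategy_tree m) : 0 <= tree_law st s.
Proof.
elim: m st s => [|m IH] st s /=; first exact: ler01.
by rewrite mulr_ge0 ?Defs.pmf_ge0// prodr_ge0.
Qed.

Lemma tree_law_sum1 m st : \sum_(s : strategy_tree m) tree_law st s = 1.
Proof.
elim: m st => [|m IH] st /=; first by rewrite big_const card_unit /= addr0.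
rewrite -(pair_bigA _ (fun i (f : {ffun A -> strategy_tree m}) =>
  policy st i * \prod_a tree_law (update st i a) (f a))) /=.
rewrite -[RHS](Defs.pmf_sum1 (policy st)); apply: eq_bigr => i _.
rewrite -mulr_sumr -(bigA_distr_bigA (fun a => tree_law (update st i a))).
by rewrite big1 ?mulr1// => a _; rewrite IH.
Qed.

Variables (D : dist R Th) (respond : Th -> I -> A) (cost : I -> R).

Fixpoint total_cost (sigma : seq A -> I) (thetas : seq Th) : R :=
  if thetas is th :: thetas' then
    cost (sigma [::])
      + total_cost (fun h => sigma (respond th (sigma [::]) :: h)) thetas'
  else 0.

Fixpoint mean_cost (m : nat) (st : S) : R :=
  if m is m'.+1 then
    \sum_th D th * \sum_i policy st i *
      (cost i + mean_cost m' (update st i (respond th i)))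
  else 0.

Lemma sum_tupleS m (F : m.+1.-tuple Th -> R) :
  \sum_thetas F thetas = \sum_th \sum_(thetas : m.-tuple Th) F [tuple of th :: thetas].
Proof.
rewrite pair_bigA /=.
rewrite (reindex (fun u : Th * m.-tuple Th => [tuple of u.1 :: u.2]))//=.
exists (fun t => (thead t, [tuple of behead t])) => [[th t] _|t _] /=.
  by congr pair; apply: val_inj.
by rewrite [RHS]tuple_eta; apply: val_inj.
Qed.

Lemma iid_sum1 m : \sum_(thetas : m.-tuple Th) \prod_(t < m) D (tnth thetas t) = 1.
Proof.
elim: m => [|m IH].
  rewrite (eq_bigr (fun=> 1)) => [|t _]; last by rewrite big_ord0.
  by rewrite sumr_const card_tuple expn0.
rewrite sum_tupleS -[RHS](Defs.pmf_sum1 D); apply: eq_bigr => th _.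
rewrite -[RHS]mulr1 -[in RHS]IH mulr_sumr; apply: eq_bigr => t _.
rewrite big_ord_recl tnth0; congr (_ * _).
by apply: eq_bigr => i _; rewrite tnthS.
Qed.

(** Drawing a whole tree in advance costs on average as much as drawing a fresh action from [policy]
    in every round. *)
Lemma mean_total_cost (i0 : I) m st :
  \sum_(s : strategy_tree m) tree_law st s *
    (\sum_(thetas : m.-tuple Th) \prod_(t < m) D (tnth thetas t)
       * total_cost (tree_action i0 s) thetas)
  = mean_cost m st.
Proof.
elim: m st => [|m IH] st.
  rewrite big1// => s _; rewrite big1 ?mulr0// => t _.
  by rewrite tuple0 /= mulr0.
pose Phi i (s : strategy_tree m) := cost i +
  \sum_(thetas : m.-tuple Th) \prod_(t < m) D (tnth thetas t)
       * total_cost (tree_action i0 s) thetas.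
have inner (s : strategy_tree m.+1) :
    \sum_(thetas : m.+1.-tuple Th) \prod_(t < m.+1) D (tnth thetas t)
       * total_cost (tree_action i0 s) thetas =
    \sum_th D th * Phi s.1 (s.2 (respond th s.1)).
  rewrite sum_tupleS; apply: eq_bigr => th _.
  rewrite /Phi -[X in X + _]mul1r -[X in X * _ + _](iid_sum1 m) mulr_suml.
  rewrite -big_split mulr_sumr.
  apply: eq_bigr => t _; rewrite big_ord_recl tnth0 /=.
  under eq_bigr do rewrite tnthS.
  by rewrite -mulrA -mulrDr.
under eq_bigr do rewrite inner mulr_sumr.
rewrite exchange_big; apply: eq_bigr => th _ /=.
transitivity (\sum_i \sum_(f : {ffun A -> strategy_tree m})
   D th * (policy st i * ((\prod_a tree_law (update st i a) (f a))
     * Phi i (f (respond th i))))).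
  rewrite pair_bigA; apply: eq_bigr => s _ /=; ring.
rewrite mulr_sumr; apply: eq_bigr => i _; rewrite -!mulr_sumr.
congr (_ * (_ * _)); rewrite (sum_prod_marginal (w := fun a => tree_law (update st i a))).
  under eq_bigr do rewrite mulrDr.
  by rewrite big_split -mulr_suml tree_law_sum1 mul1r IH.
by move=> a; exact: tree_law_sum1.
Qed.

(** The drift inequality telescopes, and the final potential is dropped because it is
    nonnegative. *)
Lemma mean_cost_potential (psi : S -> R) (kappa : R) :
    (forall st, 0 <= psi st) ->
    (forall st, \sum_th D th * (\sum_i policy st i *
       (cost i + psi (update st i (respond th i)))) <= psi st + kappa) ->
  forall m st, mean_cost m st <= psi st + m%:R * kappa.
Proof.
move=> psi0 drift; elim=> [|m IH] st /=; first by rewrite mul0r addr0.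
apply: (@le_trans _ _ (\sum_th D th * (\sum_i policy st i *
       (cost i + psi (update st i (respond th i))) + m%:R * kappa))).
  apply: ler_sum => th _; apply: ler_wpM2l; first exact: Defs.pmf_ge0.
  rewrite (_ : m%:R * kappa = \sum_i policy st i * (m%:R * kappa)); last first.
    by rewrite -mulr_suml Defs.pmf_sum1 mul1r.
  rewrite -big_split.
  apply: ler_sum => i _ /=; rewrite -mulrDr -addrA.
  by apply: ler_wpM2l; [exact: Defs.pmf_ge0|rewrite lerD2l; exact: IH].
under eq_bigr do rewrite mulrDr.
rewrite big_split -mulr_suml Defs.pmf_sum1 mul1r /=.
by have := drift st; rewrite -natr1; lra.
Qed.

End RandomStrategy.

(** * Finitely supported seeds *)

Section FiniteSeed.
Variables (R : realType) (T : finType) (t0 : T) (w : dist R T).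

Definition seed_decode (j : nat) : T := nth t0 (enum T) j.

(** Seeds are ranks in [enum T]. Every subset of [nat] is measurable, hence so is every strategy;
    ranks from [#|T|] on carry no mass. *)
Definition finite_seed_law : set nat -> \bar R :=
  msum (fun j => mscale (NngNum (Defs.pmf_ge0 w (seed_decode j))) \d_j) #|T|.

HB.instance Definition _ := Measure.on finite_seed_law.

Lemma sum_seed_decode (f : T -> R) :
  \sum_(j < #|T|) f (seed_decode j) = \sum_t f t.
Proof.
rewrite [RHS](reindex (@enum_val T T)) /=; last exact/onW_bij/enum_val_bij.
by apply: eq_bigr => j _; rewrite (enum_val_nth t0).
Qed.

Lemma finite_seed_law_setT : finite_seed_law [set: nat] = 1%E.
Proof.
transitivity (\sum_(j < #|T|) (w (seed_decode j))%:E)%E.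
  by apply: eq_bigr => j _; rewrite /= /mscale /= diracT mule1.
by rewrite sumEFin (sum_seed_decode w) Defs.pmf_sum1.
Qed.

HB.instance Definition _ :=
  Measure_isProbability.Build _ _ R finite_seed_law finite_seed_law_setT.

Lemma integral_finite_seed_law (f : T -> R) : (forall t, 0 <= f t) ->
  (\int[finite_seed_law]_j (f (seed_decode j))%:E = (\sum_t w t * f t)%:E)%E.
Proof.
move=> f0; rewrite ge0_integral_measure_sum//=; last first.
  by move=> j _; rewrite lee_fin.
rewrite -(sum_seed_decode (fun t => w t * f t)) -sumEFin.
apply: eq_bigr => j _.
rewrite ge0_integral_mscale//= ?integral_dirac//= ?diracT ?mul1e//.
by move=> i _; rewrite lee_fin.
Qed.

End FiniteSeed.

Lemma exists_finite_algorithm (R : realType) (L n A : nat) (T : finType)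
    (w : dist R T) (t0 : T)
    (sigma : T -> seq (action_profile n A) -> dist R 'I_L) :
  exists alg : algorithm R L n A,
  forall F : (seq (action_profile n A) -> dist R 'I_L) -> R,
    (forall tau, 0 <= F tau) ->
  (\int[seed_law alg]_s (F (strategy s))%:E = (\sum_t w t * F (sigma t))%:E)%E.
Proof.
have mes h l : measurable_fun [set: nat] (fun j => sigma (seed_decode t0 j) h l).
  by [].
exists (@Algorithm R L n A _ nat (finite_seed_law t0 w) _ mes) => F F0 /=.
exact: (integral_finite_seed_law t0 w (f := fun t => F (sigma t))).
Qed.

(** * The Stackelberg game as a linear bandit *)

(** Points are grouped by their features rounded down to multiples of [1 / T], and each nonempty
    cell elects a representative. Each coordinate has [T + 1] levels because the value 1 is
    attainable. *)
Lemma exists_grid_cover (R : realType) (X : Type) (Th : finType)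
    (M : X -> Th -> R) (x0 : X) (T : nat) : (0 < T)%N ->
    (forall x th, 0 <= M x th <= 1) ->
  exists arm : 'I_(T.+1 ^ #|Th|) -> X,
    forall x, exists c, forall th, M x th <= M (arm c) th + T%:R^-1.
Proof.
move=> T0 M01; have TR : 0 < T%:R :> R by rewrite ltr0n.
pose cell x : {ffun Th -> 'I_T.+1} := [ffun th => inord (Num.truncn (T%:R * M x th))].
have cellE x th : (cell x th : nat) = Num.truncn (T%:R * M x th).
  have /andP[m0 m1] := M01 x th.
  rewrite ffunE inordK// ltnS -(ler_nat R).
  apply: (@le_trans _ _ (T%:R * M x th)); last by rewrite ler_piMr// ltW.
  by rewrite truncn_le mulr_ge0// ltW.
have cardC : #|{ffun Th -> 'I_T.+1}| = (T.+1 ^ #|Th|)%N.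
  by rewrite card_ffun card_ord.
(* Empty cells also index an arm, which defaults to [x0]. *)
pose rep (f : {ffun Th -> 'I_T.+1}) : X :=
  if pselect (exists x, cell x = f) is left e then projT1 (cid e) else x0.
exists (fun c => rep (enum_val (cast_ord (esym cardC) c))) => x.
exists (cast_ord cardC (enum_rank (cell x))) => th.
rewrite cast_ordK enum_rankK /rep; case: pselect => [e|]; last by case; exists x.
case: (cid e) => z zx /=; have := cellE z th; rewrite zx cellE => E.
have /andP[m0 m1] := M01 x th; have /andP[z0 z1] := M01 z th.
have := truncnS_gt (T%:R * M x th); rewrite E => h1.
have h2 : (Num.truncn (T%:R * M z th))%:R <= T%:R * M z th.
  by rewrite truncn_le mulr_ge0// ltW.
rewrite -(ler_pM2l TR) mulrDr mulfV ?gt_eqF//.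
by move: h1; rewrite -natr1; lra.
Qed.

Lemma ln_nat_ge_half (R : realType) (T : nat) : (2 <= T)%N ->
  1 / 2 <= ln T%:R :> R.
Proof.
move=> T2; have h : 1 / 2 <= ln 2 :> R.
  rewrite -[leLHS]expRK ler_ln ?posrE ?expR_gt0//.
  (* At [1 / 2] the quadratic bound equals exactly 2. *)
  have := @expR_le_quadratic R (1 / 2) (lexx _); lra.
by apply: le_trans h _; rewrite ler_ln ?posrE ?ltr0n ?ler_nat// (leq_trans _ T2).
Qed.

Lemma ln_natS_le (R : realType) (T : nat) : (2 <= T)%N ->
  ln T.+1%:R <= 2 * ln T%:R :> R.
Proof.
move=> T2; rewrite mulr_natl -lnXn ?ltr0n ?(leq_trans _ T2)//.
rewrite ler_ln ?posrE ?exprn_gt0 ?ltr0n ?(leq_trans _ T2)// -natrX ler_nat.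
by rewrite expnS expn1; case: T T2 => [|[|T]]// _; rewrite !mulSn; lia.
Qed.

(** * Regret as a cumulative cost *)

Section StrategyRegret.
Variables (R : realType) (L n A K : nat) (G : game R L n A K).
Variables (br : response R L n A K) (D : dist R (type_profile n K)).
Variable xstar : dist R 'I_L.

(** The integrand of [expected_regret], with the history unfolded so that it depends on the seed
    only through [tau]. *)
Definition strategy_regret (T : nat)
    (tau : seq (action_profile n A) -> dist R 'I_L) : R :=
  \sum_(thetas : T.-tuple (type_profile n K)) (\prod_(t < T) D (tnth thetas t)) *
    \sum_(t < T) (expected_utility G br D xstar - expected_utility G br D
      (tau (foldl (fun h th => rcons h (br th (tau h))) [::] (take t thetas)))).

Lemma expected_regretE (alg : algorithm R L n A) (T : nat) :
  expected_regret G br alg D xstar T =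
  (\int[seed_law alg]_w (strategy_regret T (strategy w))%:E)%E.
Proof. by []. Qed.

Lemma leader_utility_itv x a : 0 <= leader_utility G x a <= 1.
Proof.
apply/andP; split.
  by apply: dist_mean_ge0 => l; have /andP[] := leader_payoff_itv G l a.
by apply: dist_mean_le => l; have /andP[] := leader_payoff_itv G l a.
Qed.

Lemma expected_utility_itv x : 0 <= expected_utility G br D x <= 1.
Proof.
apply/andP; split.
  by apply: dist_mean_ge0 => th; have /andP[] := leader_utility_itv x (br th x).
by apply: dist_mean_le => th; have /andP[] := leader_utility_itv x (br th x).
Qed.

Lemma strategy_regret_ge0 T tau : optimal_strategy G br D xstar ->
  0 <= strategy_regret T tau.
Proof.
move=> opt; apply: sumr_ge0 => thetas _; apply: mulr_ge0.
  by apply: prodr_ge0 => t _; exact: Defs.pmf_ge0.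
by apply: sumr_ge0 => t _; rewrite subr_ge0.
Qed.

Lemma strategy_regret_le T tau : strategy_regret T tau <= T%:R.
Proof.
rewrite -[leRHS]mul1r -[X in _ <= X * _](iid_sum1 D T) mulr_suml.
apply: ler_sum => thetas _.
apply: ler_wpM2l; first by apply: prodr_ge0 => t _; exact: Defs.pmf_ge0.
rewrite -[X in _ <= X%:R]card_ord -sumr_const; apply: ler_sum => t _.
set y := tau _; have /andP[_ h1] := expected_utility_itv xstar.
by have /andP[h2 _] := expected_utility_itv y; lra.
Qed.

(** Histories grow on the right whereas [total_cost] peels off the first round; this reconciles the
    two. *)
Lemma foldl_history_cons (I : Type)
    (respond : type_profile n K -> I -> action_profile n A)
    (sigma : seq (action_profile n A) -> I) a h thetas :
  foldl (fun h th => rcons h (respond th (sigma h))) (a :: h) thetas =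
  a :: foldl (fun h th => rcons h (respond th (sigma (a :: h)))) h thetas.
Proof. by elim: thetas h => //= th thetas IH h; rewrite -IH. Qed.

Lemma sum_cost_history (I : finType)
    (respond : type_profile n K -> I -> action_profile n A) (cost : I -> R)
    (sigma : seq (action_profile n A) -> I) thetas :
  \sum_(t < size thetas) cost (sigma
    (foldl (fun h th => rcons h (respond th (sigma h))) [::] (take t thetas))) =
  total_cost respond cost sigma thetas.
Proof.
elim: thetas sigma => [|th thetas IH] sigma /=; first by rewrite big_ord0.
rewrite big_ord_recl /=; congr (_ + _); rewrite -IH.
by apply: eq_bigr => t _ /=; rewrite foldl_history_cons.
Qed.

Lemma strategy_regret_total_cost (I : finType) (arm : I -> dist R 'I_L)
    (sigma : seq (action_profile n A) -> I) T :
  strategy_regret T (fun h => arm (sigma h)) =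
  \sum_(thetas : T.-tuple (type_profile n K)) (\prod_(t < T) D (tnth thetas t)) *
    total_cost (fun th c => br th (arm c))
      (fun c => expected_utility G br D xstar - expected_utility G br D (arm c))
      sigma thetas.
Proof.
apply: eq_bigr => thetas _; congr (_ * _).
by rewrite -sum_cost_history size_tuple.
Qed.

End StrategyRegret.

(** The algorithm is fixed before [br] is known; this lets it compute features from any one
    favorable response. *)
Lemma leader_favorable_utility_unique (R : realType) (L n A K : nat)
    (G : game R L n A K) (br br' : response R L n A K) th x :
  leader_favorable_response G br -> leader_favorable_response G br' ->
  leader_utility G x (br th x) = leader_utility G x (br' th x).
Proof.
move=> /(_ th x)[b1 b2] /(_ th x)[b1' b2'].
by apply/eqP; rewrite eq_le b2'// b2.
Qed.

(** * The algorithms for short and long horizons *)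

Section Algorithms.
Variables (R : realType) (L n A K : nat) (G : game R L n A K) (T : nat).
Local Notation d := (#|type_profile n K|).

Lemma exists_linear_regret_algorithm (x0 : dist R 'I_L) :
  exists alg : algorithm R L n A, forall D br xstar,
    optimal_strategy G br D xstar ->
    (expected_regret G br alg D xstar T <= T%:R%:E)%E.
Proof.
have [w _] := exists_point_mass R tt.
have [alg algE] := exists_finite_algorithm w tt
  (fun _ (_ : seq (action_profile n A)) => x0).
exists alg => D br xstar opt; rewrite expected_regretE algE ?lee_fin.
  by apply: dist_mean_le => _; exact: strategy_regret_le.
by move=> tau; exact: strategy_regret_ge0.
Qed.

Lemma exists_exp2_algorithm (x0 : dist R 'I_L) (br0 : response R L n A K)
    (eta : R) :
    leader_favorable_response G br0 -> (0 < T)%N -> (0 < d)%N ->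
    0 < eta -> 16 * eta * d%:R <= 1 ->
  exists alg : algorithm R L n A, forall D br xstar,
    leader_favorable_response G br -> optimal_strategy G br D xstar ->
    (expected_regret G br alg D xstar T <=
      (ln (T.+1 ^ d)%:R / eta + T%:R * (12 * eta * d%:R + T%:R^-1))%:E)%E.
Proof.
move=> fav0 T0 d0 eta0 etad.
pose M x th := leader_utility G x (br0 th x).
have M01 x th : 0 <= M x th <= 1 by exact: leader_utility_itv.
have [arm armP] := exists_grid_cover x0 T0 M01.
have N0 : (0 < T.+1 ^ d)%N by rewrite expn_gt0.
have [policy [k step]] := exists_exp2_policy N0 d0 (fun c => M01 (arm c)) eta0 etad.
(* The reward of the played arm is computed from the observed joint action alone, so action feedback
   suffices. *)
pose update (st : 'I_(T.+1 ^ d) -> R) c a b :=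
  st b + k st b c * leader_utility G (arm c) a.
pose st0 : 'I_(T.+1 ^ d) -> R := fun=> 0; pose c0 := Ordinal N0.
have [w wE] := exists_dist (@tree_law_ge0 _ _ _ _ policy update T st0)
  (tree_law_sum1 policy update T st0).
have [alg algE] := exists_finite_algorithm w (constant_tree _ c0 T)
  (fun s h => arm (tree_action c0 s h)).
exists alg => D br xstar fav opt.
rewrite expected_regretE algE => [|tau]; last exact: strategy_regret_ge0.
rewrite lee_fin.
have MbrE x th : leader_utility G x (br th x) = M x th.
  exact: leader_favorable_utility_unique.
pose cost c := expected_utility G br D xstar - expected_utility G br D (arm c).
pose respond th c := br th (arm c).
rewrite (eq_bigr (fun s => tree_law policy update st0 s *
   (\sum_(thetas : T.-tuple (type_profile n K)) \prod_(t < T) D (tnth thetas t)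
       * total_cost respond cost (tree_action c0 s) thetas))); last first.
  by move=> s _; rewrite wE strategy_regret_total_cost.
rewrite mean_total_cost; have [b' b'P] := armP xstar.
(* [b'] is the arm whose cell contains [xstar]. It depends on the unknown [D], but only the analysis
   refers to it. *)
pose psi st := log_partition eta st / eta - st b'.
have psi0 st : 0 <= psi st.
  rewrite subr_ge0 ler_pdivlMr// mulrC; exact: log_partition_ge.
apply: le_trans (mean_cost_potential (kappa := 12 * eta * d%:R + T%:R^-1) psi0 _ T st0) _.
  move=> st; rewrite addrA.
  pose gain c th := M (arm b') th - M (arm c) th.
  (* Replacing [xstar] by the arm [b'] costs at most [1 / T] per round. *)
  have cost_le c : cost c <= T%:R^-1 + \sum_th D th * gain c th.
    rewrite /cost /expected_utility -sumrB -[X in X + _]mul1r.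
    rewrite -[X in X * _ + _](Defs.pmf_sum1 D) mulr_suml -big_split /=.
    apply: ler_sum => th _; rewrite -mulrBr -mulrDr !MbrE.
    apply: ler_wpM2l; first exact: Defs.pmf_ge0.
    by have := b'P th; rewrite /gain; lra.
  pose next c th := psi (update st c (respond th c)).
  have drift_le : \sum_th D th * (\sum_c policy st c * (cost c + next c th)) <=
      T%:R^-1 + \sum_th D th * (\sum_c policy st c * (gain c th + next c th)).
    under eq_bigr do rewrite (eq_bigr _ (fun c _ => mulrDr _ _ _)) big_split mulrDr.
    under [in leRHS]eq_bigr do
      rewrite (eq_bigr _ (fun c _ => mulrDr _ _ _)) big_split mulrDr.
    rewrite !big_split /= addrA lerD2r -mulr_suml Defs.pmf_sum1 mul1r.
    apply: (@le_trans _ _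
      (\sum_c policy st c * (T%:R^-1 + \sum_th D th * gain c th))).
      by apply: ler_sum => c _; apply: ler_wpM2l; [exact: Defs.pmf_ge0|].
    under [in leLHS]eq_bigr do rewrite mulrDr mulr_sumr.
    rewrite big_split -mulr_suml Defs.pmf_sum1 mul1r lerD2l exchange_big /=.
    rewrite le_eqVlt; apply/orP; left; apply/eqP; apply: eq_bigr => th _.
    by rewrite mulr_sumr; apply: eq_bigr => c _; rewrite mulrCA.
  apply: le_trans drift_le _; rewrite [leRHS]addrC lerD2l.
  apply: dist_mean_le => th; apply: le_trans (step st th b').
  rewrite le_eqVlt; apply/orP; left; apply/eqP; apply: eq_bigr => c _.
  by rewrite /next /psi /update /respond MbrE.
rewrite lerD2r /psi /log_partition subr0.
under eq_bigr do rewrite mulr0 expR0.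
by rewrite sumr_const card_ord.
Qed.

End Algorithms.

Theorem theorem5p1 (R : realType) :
  exists C : R, 0 < C /\
  forall (L n A K T : nat) (G : game R L n A K),
    (2 <= L)%N -> (1 <= n)%N -> (1 <= A)%N -> (1 <= K)%N -> (2 <= T)%N ->
  exists alg : algorithm R L n A,
  forall (D : dist R (type_profile n K)) (br : response R L n A K),
    leader_favorable_response G br ->
  forall xstar : dist R 'I_L,
    optimal_strategy G br D xstar ->
    (expected_regret G br alg D xstar T
       <= (C * (K ^ n)%:R * Num.sqrt T%:R * ln T%:R)%:E)%E.
Proof.
(* A short horizon has [T <= 16 * d * r], and [ln T >= 1/2] doubles 16 to 32; the long one needs at
   most [2 + 2 * 13 = 28]. *)
exists 32; split; first by [].
move=> L n A K T G L2 n1 A1 K1 T2.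
have [x0 _] := exists_point_mass R (Ordinal (ltnW L2)).
have T0 : (0 < T)%N by exact: ltnW.
have cardTh : #|type_profile n K| = (K ^ n)%N by rewrite card_ffun !card_ord.
have d0 : (0 < K ^ n)%N by rewrite expn_gt0 K1.
have lnT := ln_nat_ge_half R T2.
have TR : 0 < T%:R :> R by rewrite ltr0n.
set r := Num.sqrt T%:R; have r0 : 0 < r by rewrite sqrtr_gt0.
have rr : r * r = T%:R by rewrite -expr2 sqr_sqrtr// ltW.
have r1 : 1 <= r by rewrite -[leLHS]sqrtr1 ler_wsqrtr// ler1n.
have dR : 1 <= (K ^ n)%:R :> R by rewrite ler1n.
set d : R := (K ^ n)%:R in dR *.
have dr1 : 1 <= d * r by rewrite -[leLHS]mulr1 ler_pM.
have drl : 1 / 2 * (d * r) <= ln T%:R * (d * r).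
  by apply: ler_wpM2r lnT; lra.
have short_horizon : T%:R <= 16 * d * r ->
    exists alg : algorithm R L n A,
    forall (D : dist R (type_profile n K)) (br : response R L n A K),
      leader_favorable_response G br ->
    forall xstar : dist R 'I_L,
      optimal_strategy G br D xstar ->
      (expected_regret G br alg D xstar T <= (32 * d * r * ln T%:R)%:E)%E.
  move=> Tdr; have [alg algP] := exists_linear_regret_algorithm G T x0.
  exists alg => D br _ xstar opt; apply: le_trans (algP _ _ _ opt) _.
  by rewrite lee_fin; lra.
(* With [eta = 1 / r], the condition [16 * eta * d <= 1] says [16 * d <= r]. *)
have [rd|dr] := leP r (16 * d).
  by apply: short_horizon; rewrite -rr ler_pM2r.
(* A favorable response is needed to define the features; if there is none, the claim is vacuous for
   every algorithm. *)
have [[br0 fav0]|nobr] := pselect (exists br0, leader_favorable_response G br0);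
  last first.
  have [alg _] := exists_linear_regret_algorithm G T x0.
  by exists alg => D br fav; case: nobr; exists br.
have [|||alg algP] := @exists_exp2_algorithm R L n A K G T x0 br0 r^-1 fav0 T0.
- by rewrite cardTh.
- by rewrite invr_gt0.
- by rewrite cardTh -/d mulrAC ler_pdivrMr// mul1r ltW.
exists alg => D br fav xstar opt; apply: le_trans (algP _ _ _ fav opt) _.
rewrite lee_fin cardTh -/d invrK mulrDr mulfV ?gt_eqF//.
rewrite natrX lnXn ?ltr0n// -[ln _ *+ _]mulr_natr -/d.
have -> : T%:R * (12 * r^-1 * d) = 12 * (d * r).
  by rewrite -rr; field; rewrite gt_eqF.
have : ln T.+1%:R * (d * r) <= 2 * ln T%:R * (d * r).
  by apply: ler_wpM2r (ln_natS_le R T2); lra.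
lra.
Qed.
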